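(* Let $f:\mathbb{R}^{d_1}\times\mathbb{R}^{d_2}\to\mathbb{R}$ be continuously differentiable, have Lipschitz gradient with constant $l>0$, satisfy the existence-of-saddle-point assumption, and satisfy the two-sided PL condition with constants $\mu_1,\mu_2>0$, where $\mu_1,\mu_2\le l$. Let $(x_t,y_t)_{t\ge0}$ be generated by AGDA with $\tau_1=\frac{\mu_2^2}{18l^3}$ and $\tau_2=\frac1l$, and put $P_t:=a_t+\frac1{10}b_t$. Then for all $t\ge0$, $$P_t\le\Big(1-\frac{\mu_1\mu_2^2}{36l^3}\Big)^tP_0 .$$ Furthermore, $\{(x_t,y_t)\}_t$ converges to some saddle point $(x^*,y^* )$ of $f$, and for all $t\ge 0$ $$\|x_t-x^*\|^2+\|y_t-y^*\|^2\le\alpha\Big(1-\frac{\mu_1\mu_2^2}{36l^3}\Big)^tP_0,$$ where $\alpha$ is a constant depending only on $\mu_1,\mu_2$ and $l$.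
   Context: Norms are Euclidean. Problem: $\min_{x\in\mathbb{R}^{d_1}}\max_{y\in\mathbb{R}^{d_2}} f(x,y)$. Lipschitz gradient with constant $l$: for all $x_1,x_2\in\mathbb{R}^{d_1}$, $y_1,y_2\in\mathbb{R}^{d_2}$, $\|\nabla_x f(x_1,y_1)-\nabla_x f(x_2,y_2)\|\le l[\|x_1-x_2\|+\|y_1-y_2\|]$ and $\|\nabla_y f(x_1,y_1)-\nabla_y f(x_2,y_2)\|\le l[\|x_1-x_2\|+\|y_1-y_2\|]$. A saddle point is $(x^*,y^* )$ with $f(x^*,y)\le f(x^*,y^* )\le f(x,y^* )$ for all $(x,y)$. Existence-of-saddle-point assumption: $f$ has at least one saddle point; moreover for every $y$, $\min_x f(x,y)$ has a nonempty solution set and finite optimal value, and for every $x$, $\max_y f(x,y)$ has a nonempty solution set and finite optimal value. Two-sided PL condition with constants $\mu_1,\mu_2>0$: for all $(x,y)$, $\|\nabla_x f(x,y)\|^2\ge 2\mu_1[f(x,y)-\min_{x'}f(x',y)]$ and $\|\nabla_y f(x,y)\|^2\ge 2\mu_2[\max_{y'}f(x,y')-f(x,y)]$. AGDA (alternating gradient descent ascent): from a given $(x_0,y_0)$, for $t=0,1,2,\dots$, $x_{t+1}=x_t-\tau_1\nabla_xf(x_t,y_t)$, then $y_{t+1}=y_t+\tau_2\nabla_yf(x_{t+1},y_t)$. Notation: $g(x):=\max_y f(x,y)$, $g^*:=\min_x g(x)$, $a_t:=g(x_t)-g^*$, $b_t:=g(x_t)-f(x_t,y_t)$. *)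

(* Defs.v *)
From HB Require Import structures.
From mathcomp Require Import all_boot all_order all_algebra.
From mathcomp Require Import all_classical all_reals all_analysis.
Set Implicit Arguments.
Unset Strict Implicit.
Unset Printing Implicit Defensive.
Import Order.TTheory GRing.Theory Num.Theory.
Import numFieldNormedType.Exports.
Local Open Scope classical_set_scope.
Local Open Scope ring_scope.

(* The library's norm `|v| on 'rV[R]_d is the max norm, hence this definition. *)
Definition enorm (R : realType) (d : nat) (v : 'rV[R]_d) : R :=
  Num.sqrt (\sum_(i < d) v 0 i ^+ 2).

Definition grad (R : realType) (d : nat) (h : 'rV[R]_d -> R) (v : 'rV[R]_d) :
    'rV[R]_d :=
  \row_(i < d) 'D_(delta_mx 0 i) h v.

Section Minimax.
Context {R : realType} {d1 d2 : nat}.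
Implicit Types f : 'rV[R]_d1 -> 'rV[R]_d2 -> R.

Definition grad_x f (x : 'rV[R]_d1) (y : 'rV[R]_d2) : 'rV[R]_d1 :=
  grad (f ^~ y) x.

Definition grad_y f (x : 'rV[R]_d1) (y : 'rV[R]_d2) : 'rV[R]_d2 :=
  grad (f x) y.

Definition continuously_differentiable f : Prop :=
  [/\ forall z : 'rV[R]_d1 * 'rV[R]_d2, differentiable (uncurry f) z,
      continuous (uncurry (grad_x f))
    & continuous (uncurry (grad_y f))].

Definition lipschitz_gradient f (l : R) : Prop :=
  forall (x1 x2 : 'rV[R]_d1) (y1 y2 : 'rV[R]_d2),
    enorm (grad_x f x1 y1 - grad_x f x2 y2)
      <= l * (enorm (x1 - x2) + enorm (y1 - y2)) /\
    enorm (grad_y f x1 y1 - grad_y f x2 y2)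
      <= l * (enorm (x1 - x2) + enorm (y1 - y2)).

Definition saddle_point f (xs : 'rV[R]_d1) (ys : 'rV[R]_d2) : Prop :=
  forall (x : 'rV[R]_d1) (y : 'rV[R]_d2),
    f xs y <= f xs ys /\ f xs ys <= f x ys.

(* An attained optimal value of a real-valued function is automatically finite,
   so the last two clauses only assert that solutions exist. *)
Definition saddle_point_existence f : Prop :=
  [/\ exists xs ys, saddle_point f xs ys,
      forall y, exists xm, forall x, f xm y <= f x y
    & forall x, exists ym, forall y, f x y <= f x ym].

(* The real-valued [sup] and [inf] return a default value on unbounded sets;
   under [saddle_point_existence] all those below are attained, so that they are
   the maxima and minima of the range. *)
Definition two_sided_PL f (mu1 mu2 : R) : Prop :=
  forall (x : 'rV[R]_d1) (y : 'rV[R]_d2),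
    enorm (grad_x f x y) ^+ 2 >= 2 * mu1 * (f x y - inf (range (f ^~ y))) /\
    enorm (grad_y f x y) ^+ 2 >= 2 * mu2 * (sup (range (f x)) - f x y).

Definition primal f (x : 'rV[R]_d1) : R := sup (range (f x)).

Definition primal_min f : R := inf (range (primal f)).

Definition AGDA f (tau1 tau2 : R)
    (x : nat -> 'rV[R]_d1) (y : nat -> 'rV[R]_d2) : Prop :=
  forall t : nat,
    x t.+1 = x t - tau1 *: grad_x f (x t) (y t) /\
    y t.+1 = y t + tau2 *: grad_y f (x t.+1) (y t).

Definition potential f (x : 'rV[R]_d1) (y : 'rV[R]_d2) : R :=
  (primal f x - primal_min f) + 10^-1 * (primal f x - f x y).

End Minimax.

(* Main.v *)
(* With g = primal f, the two-sided PL condition gives quadratic growth of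
   y |-> g x - f x y around its maximizers; hence maximizers move Lipschitz
   continuously with x, so g satisfies a descent inequality with constant
   4 l^2 / mu2, and the error in using grad_x f x y as gradient of g is
   controlled by the gap b. The decrease of a under a descent step and of b
   under an ascent step combine into contraction of a + b/10. Both gradients
   along the iterates are O(sqrt P), so the steps decay geometrically; the
   limit is critical, and under PL a critical point is a saddle point. *)
Require Import Defs.
From HB Require Import structures.
From mathcomp Require Import all_boot all_order all_algebra.
From mathcomp Require Import all_classical all_reals all_analysis.
From mathcomp Require Import ring lra.
Set Implicit Arguments.
Unset Strict Implicit.
Unset Printing Implicit Defensive.
Import Order.TTheory GRing.Theory Num.Theory.
Import numFieldNormedType.Exports.
Local Open Scope classical_set_scope.
Local Open Scope ring_scope.

(** * Euclidean inner product and norm *)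

Definition dot {R : realType} {d : nat} (u v : 'rV[R]_d) : R :=
  \sum_(i < d) u 0 i * v 0 i.

Section Euclidean.
Context {R : realType} {d : nat}.
Implicit Types (u v w : 'rV[R]_d) (c : R).

Lemma dotC u v : dot u v = dot v u.
Proof. by apply: eq_bigr => i _; rewrite mulrC. Qed.

Lemma dotDr u v w : dot u (v + w) = dot u v + dot u w.
Proof. by rewrite -big_split; apply: eq_bigr => i _; rewrite mxE mulrDr. Qed.

Lemma dotZr c u v : dot u (c *: v) = c * dot u v.
Proof. by rewrite mulr_sumr; apply: eq_bigr => i _; rewrite mxE mulrCA. Qed.

Lemma dotNr u v : dot u (- v) = - dot u v.
Proof. by rewrite -scaleN1r dotZr mulN1r. Qed.

Lemma dotDl u v w : dot (u + v) w = dot u w + dot v w.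
Proof. by rewrite dotC dotDr !(dotC w). Qed.

Lemma dotNl u v : dot (- u) v = - dot u v.
Proof. by rewrite dotC dotNr dotC. Qed.

Lemma dot_ge0 u : 0 <= dot u u.
Proof. by apply: sumr_ge0 => i _; rewrite -expr2 sqr_ge0. Qed.

Lemma enorm_ge0 u : 0 <= enorm u.
Proof. exact: sqrtr_ge0. Qed.

Lemma sqr_enorm u : enorm u ^+ 2 = dot u u.
Proof.
rewrite sqr_sqrtr; first by apply: eq_bigr => i _; rewrite expr2.
by apply: sumr_ge0 => i _; exact: sqr_ge0.
Qed.

Lemma enormZ c u : enorm (c *: u) = `|c| * enorm u.
Proof.
apply/eqP; rewrite -(@eqrXn2 _ 2) ?mulr_ge0 ?enorm_ge0 //.
by rewrite exprMn !sqr_enorm dotZr dotC dotZr real_normK ?num_real// mulrA.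
Qed.

Lemma enormN u : enorm (- u) = enorm u.
Proof. by rewrite -scaleN1r enormZ normrN1 mul1r. Qed.

Lemma enormB u v : enorm (u - v) = enorm (v - u).
Proof. by rewrite -enormN opprB. Qed.

Lemma enorm0 : enorm (0 : 'rV[R]_d) = 0.
Proof. by rewrite -(scale0r 0) enormZ normr0 mul0r. Qed.

Lemma enorm_eq0 u : enorm u = 0 -> u = 0.
Proof.
move=> u0; have /eqP := sqr_enorm u.
rewrite u0 expr0n /= eq_sym psumr_eq0 => [/allP H|i _]; last first.
  by rewrite -expr2 sqr_ge0.
by apply/rowP => i; have := H i (mem_index_enum _); rewrite -expr2 sqrf_eq0 mxE => /eqP.
Qed.

(** Cauchy-Schwarz: expand the squared norm of [enorm v *: u - enorm u *: v] and divide by the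
    product of the norms. *)
Lemma dot_le u v : dot u v <= enorm u * enorm v.
Proof.
have dot0 w : dot 0 w = 0 by rewrite /dot big1// => i _; rewrite mxE mul0r.
have [/enorm_eq0 ->|u0] := eqVneq (enorm u) 0; first by rewrite dot0 enorm0 mul0r.
have [/enorm_eq0 ->|v0] := eqVneq (enorm v) 0.
  by rewrite dotC dot0 enorm0 mulr0.
have ab0 : 0 < enorm u * enorm v by rewrite mulr_gt0// lt0r enorm_ge0 ?u0 ?v0.
have := dot_ge0 (enorm v *: u - enorm u *: v).
rewrite !(dotDl, dotDr, dotNl, dotNr, dotZr) !(dotC (_ *: _)).
rewrite !(dotDl, dotDr, dotNl, dotNr, dotZr) -!sqr_enorm (dotC v u).
move: (enorm u) (enorm v) (dot u v) ab0 => a b p ab0 H.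
by have : 0 <= (a * b) * (a * b - p); [lra|rewrite pmulr_rge0// subr_ge0].
Qed.

Lemma enormD u v : enorm (u + v) <= enorm u + enorm v.
Proof.
rewrite -(@ler_pXn2r _ 2) ?nnegrE ?addr_ge0 ?enorm_ge0//.
rewrite sqrrD !sqr_enorm dotDl !dotDr (dotC v u).
by have := dot_le u v; lra.
Qed.

Lemma enorm_coord u i : `|u 0 i| <= enorm u.
Proof.
rewrite -sqrtr_sqr ler_wsqrtr// (bigD1 i)//= lerDl.
by apply: sumr_ge0 => j _; exact: sqr_ge0.
Qed.

(** Convergence of row vectors refers to the max norm; this transfers Euclidean error bounds to
    it. *)
Lemma norm_le_enorm u : `|u| <= enorm u.
Proof.
rewrite /Num.norm /= mx_normrE; apply/bigmax_leP; split; first exact: enorm_ge0.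
by move=> [i j] _ /=; rewrite (ord1 i) enorm_coord.
Qed.

End Euclidean.

(** * Quadratic upper bound for functions with Lipschitz gradient *)

Section DescentLemma.
Context {R : realType} {d : nat}.
Variables (h : 'rV[R]_d -> R).
Hypothesis dh : forall u, differentiable h u.

Lemma derive_dot_grad u w : 'D_w h u = dot (grad h u) w.
Proof.
rewrite deriveE// [w in LHS]row_sum_delta linear_sum /=.
by apply: eq_bigr => i _; rewrite linearZ /= mxE deriveE// mulrC.
Qed.

Lemma is_derive_line v w (s : R) :
  is_derive s 1 (fun s => h (v + s *: w)) (dot (grad h (v + s *: w)) w).
Proof.
have H : is_diff s (fun s : R => v + s *: w) ( *:%R ^~ w).
  apply: is_diff_eq.
  by apply/funext => x; rewrite /= ?add0r.
have ds := is_diff_comp H (differentiableP (dh (v + s *: w))).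
have dl : differentiable (h \o (fun s : R => v + s *: w)) s by exact: ex_diff.
apply: DeriveDef; first exact/derivable1_diffP.
by rewrite deriveE// diff_val /= scale1r -derive_dot_grad deriveE.
Qed.

Variable l : R.
Hypothesis lh : forall u v, enorm (grad h u - grad h v) <= l * enorm (u - v).

(** Along the segment, [phi] is [h] minus its quadratic model. By Cauchy-Schwarz and the Lipschitz
    bound its derivative is nonpositive on [0, 1], so the mean value theorem gives
    [phi 1 <= phi 0]. *)
Lemma descent u w : h (u + w) <= h u + dot (grad h u) w + l / 2 * enorm w ^+ 2.
Proof.
pose phi (s : R) := h (u + s *: w) - s * dot (grad h u) w - l / 2 * enorm w ^+ 2 * s ^+ 2.
pose dphi (s : R) := dot (grad h (u + s *: w) - grad h u) w - l * enorm w ^+ 2 * s.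
have dd (s : R) : is_derive s 1 phi (dphi s).
  have H := is_derive_line u w s.
  rewrite /phi; apply: is_derive_eq.
  by rewrite /dphi dotDl dotNl /GRing.scale /=; field.
have [|c] := @MVT_segment _ phi dphi 0 1 ler01 (fun x _ => dd x).
  apply: derivable_within_continuous => x _; exact: (@ex_derive _ _ _ _ _ _ _ (dd x)).
rewrite in_itv /= => /andP[c0 c1].
have -> : phi 1 = h (u + w) - dot (grad h u) w - l / 2 * enorm w ^+ 2.
  by rewrite /phi scale1r; ring.
have -> : phi 0 = h u by rewrite /phi scale0r addr0; ring.
have : dphi c <= 0.
  have := dot_le (grad h (u + c *: w) - grad h u) w.
  have := lh (u + c *: w) u.
  rewrite (_ : u + c *: w - u = c *: w); last by rewrite addrAC subrr add0r.
  rewrite enormZ ger0_norm// /dphi.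
  have := enorm_ge0 w; move: (enorm (_ - _)) (dot _ w) (enorm w) => a b e; nra.
by lra.
Qed.

End DescentLemma.

Lemma le0_of_cvg0 (R : realType) (a c : R) (u : nat -> R) :
  u @ \oo --> (0 : R) -> (forall n, a <= c * u n) -> a <= 0.
Proof.
move=> u0 H; rewrite -(mulr0 c).
apply: (@ler_cvg_to _ \oo _ R (fun=> a) (fun n => c * u n)).
- exact: cvg_cst.
- by apply: cvgM => //; exact: cvg_cst.
- by near=> n; exact: H.
Unshelve. all: by end_near.
Qed.

(** * Convergence of sequences whose steps are bounded by a telescoping sequence *)

Section FiniteLength.
Context {R : realType} {d : nat}.
Variables (z : nat -> 'rV[R]_d) (s : nat -> R).
Hypothesis step_le : forall k, enorm (z k.+1 - z k) <= s k - s k.+1.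
Hypothesis s0 : s @ \oo --> (0 : R).

Lemma enorm_sub_le_length n m : (n <= m)%N -> enorm (z m - z n) <= s n - s m.
Proof.
elim: m => [|m IH]; first by rewrite leqn0 => /eqP ->; rewrite !subrr enorm0.
rewrite leq_eqVlt => /predU1P[->|]; first by rewrite !subrr enorm0.
rewrite ltnS => /IH {}IH; rewrite -(subrKA (z m)).
by rewrite (le_trans (enormD _ _))//; have := step_le m; lra.
Qed.

Lemma finite_length_cvg : exists zs, forall n, enorm (z n - zs) <= s n.
Proof.
have sni : {homo s : n m / (n <= m)%N >-> m <= n}.
  by move=> n m nm; rewrite -subr_ge0 (le_trans _ (enorm_sub_le_length nm))// enorm_ge0.
have sge0 n : 0 <= s n.
  by rewrite -(cvg_lim _ s0)//; apply: nonincreasing_cvgn_ge => //; exact: cvgP s0.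
have cvz i : cvgn (fun n => z n 0 i).
  have zi n m : (n <= m)%N -> `|z m 0 i - z n 0 i| <= s n - s m.
    move=> nm; apply: le_trans (enorm_sub_le_length nm).
    by have := enorm_coord (z m - z n) i; rewrite !mxE.
  (* The sum [z n 0 i + s n] is nonincreasing, as a coordinate moves by at most the decrease of [s],
     and it is bounded below; monotone convergence then replaces a Cauchy argument. *)
  have -> : (fun n => z n 0 i) = (fun n => (z n 0 i + s n) - s n).
    by apply/funext => n; rewrite addrK.
  apply: is_cvgB; last exact: cvgP s0.
  apply: nonincreasing_is_cvgn.
    by move=> n m /zi; rewrite ler_norml => /andP[]; lra.
  exists (z 0%N 0 i - s 0%N) => _ [n _ <-].
  by have := zi 0%N n isT; have := sge0 n; rewrite ler_norml => ? /andP[]; lra.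
exists (\row_i limn (fun n => z n 0 i)) => n.
(* The squared norm is a finite sum of products of coordinates, so the coordinatewise limits suffice
   to pass to the limit in [enorm (z m - z n) <= s n]. *)
rewrite -(@ler_pXn2r _ 2) ?nnegrE ?enorm_ge0// sqr_enorm.
set zs := \row_i _.
have c : (fun m => dot (z n - z m) (z n - z m)) @ \oo --> dot (z n - zs) (z n - zs).
  apply: cvg_big => [|i _]; first exact: add_continuous.
  have H : (fun m => (z n - z m) 0 i) @ \oo --> (z n - zs) 0 i.
    have -> : (fun m => (z n - z m) 0 i) = (fun m => z n 0 i - z m 0 i).
      by apply/funext => m; rewrite !mxE.
    by rewrite !mxE; apply: cvgB; [exact: cvg_cst|exact: cvz].
  exact: cvgM.
apply: (ler_cvg_to c (cvg_cst (s n ^+ 2))).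
near=> m.
rewrite -sqr_enorm ler_pXn2r ?nnegrE ?enorm_ge0// enormB.
have nm : (n <= m)%N by near: m; exact: nbhs_infty_ge.
by have := enorm_sub_le_length nm; have := sge0 m; lra.
Unshelve. all: by end_near.
Qed.

End FiniteLength.

(** * Decrease achieved by a single gradient step *)

Section DescentStep.
Context {R : realType} {d : nat}.
Variables (h : 'rV[R]_d -> R) (u g : 'rV[R]_d) (l : R).
Hypothesis descent_le :
  forall w, h (u + w) <= h u + dot g w + l / 2 * enorm w ^+ 2.

(** The quadratic model is assumed at one point [u] and with an arbitrary vector [g], so that this
    also applies to negated functions and to surrogate gradients. *)
Lemma gradient_step eta :
  h (u - eta *: g) <= h u - eta * (1 - l * eta / 2) * enorm g ^+ 2.
Proof.
have := descent_le (- (eta *: g)).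
rewrite dotNr dotZr -sqr_enorm enormN enormZ exprMn real_normK ?num_real//.
by lra.
Qed.

(** A step of size 1/l lowers [h] by [enorm g ^+ 2 / (2 * l)], yet cannot go below [m]. *)
Lemma sqr_grad_le m : 0 < l -> (forall v, m <= h v) ->
  enorm g ^+ 2 <= 2 * l * (h u - m).
Proof.
move=> l0 h_ge; have := gradient_step l^-1; have := h_ge (u - l^-1 *: g).
rewrite mulfV ?gt_eqF// => h1 h2.
have {h1 h2} : l^-1 * (enorm g ^+ 2 / 2) <= h u - m by lra.
by rewrite ler_pdivrMl//; lra.
Qed.

End DescentStep.

(** * Quadratic growth from the PL inequality, via the length of the gradient descent path *)

Section GradientDescent.
Context {R : realType} {d : nat}.
Variables (h : 'rV[R]_d -> R) (G : 'rV[R]_d -> 'rV[R]_d) (l mu m : R).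
Hypothesis l0 : 0 < l.
Hypothesis descent_le :
  forall u w, h (u + w) <= h u + dot (G u) w + l / 2 * enorm w ^+ 2.
Hypothesis h_ge : forall u, m <= h u.
Hypothesis mu0 : 0 < mu.
Hypothesis mul : mu <= l.
Hypothesis lipG : forall u v, enorm (G u - G v) <= l * enorm (u - v).
Hypothesis PL : forall u, 2 * mu * (h u - m) <= enorm (G u) ^+ 2.

Let eta := (4 * l)^-1.
Let K := Num.sqrt (3 / mu).
Let gap u := Num.sqrt (h u - m).
Let next u := u - eta *: G u.

Let gap2 u : gap u ^+ 2 = h u - m.
Proof. by rewrite sqr_sqrtr// subr_ge0. Qed.

Let gap_ge0 u : 0 <= gap u. Proof. exact: sqrtr_ge0. Qed.

Let gap_next u : gap (next u) ^+ 2 <= gap u ^+ 2 - 7 / 8 * (eta * enorm (G u) ^+ 2).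
Proof.
rewrite !gap2; have := gradient_step (descent_le u) eta; rewrite -/(next u).
have -> : l * eta = 4^-1 by rewrite /eta invfM mulrCA mulfV ?mulr1// gt_eqF.
by lra.
Qed.

(** Lojasiewicz argument: the square root of the gap drops in proportion to the step length, so the
    lengths telescope. *)
Let step_length u : enorm (next u - u) <= K * gap u - K * gap (next u).
Proof.
have eta0 : 0 < eta by rewrite invr_gt0 mulr_gt0.
have K0 : 0 < K by rewrite sqrtr_gt0 divr_gt0//; lra.
have X1 : eta * mu <= 4^-1 by rewrite /eta invfM -mulrA ler_piMr// ler_pdivrMl// mulr1.
have X0 : 0 < eta * mu by rewrite mulr_gt0.
rewrite addrAC subrr add0r enormN enormZ gtr0_norm// -mulrBr -ler_pdivrMl//.
set g := enorm (G u); set e := K^-1 * (eta * g).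
have e0 : 0 <= e.
  by apply: mulr_ge0; [rewrite invr_ge0 ltW|rewrite mulr_ge0 ?enorm_ge0 ?ltW].
have e2 : e ^+ 2 = eta * g ^+ 2 * (eta * mu) / 3.
  rewrite /e exprMn exprVn sqr_sqrtr ?divr_ge0 ?ltW// ?ltr0n//.
  by field; rewrite gt_eqF.
clearbody e.
have P : 2 * (eta * mu) * gap u ^+ 2 <= eta * g ^+ 2.
  by rewrite gap2; have := PL u; rewrite -/g -(ler_pM2l eta0); lra.
have := gap_next u; rewrite -/g.
have := gap_ge0 u; have := gap_ge0 (next u).
move: (gap u) (gap (next u)) P e2 => p q P e2 q0 p0 qp.
have a0 : 0 <= eta * g ^+ 2 by rewrite mulr_ge0 ?sqr_ge0// ltW.
(* With p, q the root gaps before and after the step, a = eta g^2 and X = eta mu, the goal is q <= p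
   - e. As q^2 <= p^2 - 7/8 a, it suffices that e <= p and p e <= 7/16 a. The latter follows from
   e^2 = a X / 3 and the PL bound 2 X p^2 <= a, since 1/6 <= (7/16)^2. *)
move: (eta * g ^+ 2) (eta * mu) a0 X1 X0 P e2 qp => a X a0 X1 X0 P e2 qp.
have ep : e <= p.
  rewrite -(@ler_pXn2r _ 2)// e2; have := sqr_ge0 q.
  have : a * X <= a / 4 by rewrite ler_wpM2l.
  by lra.
have pe : p * e <= 7 / 16 * a.
  rewrite -(@ler_pXn2r _ 2) ?nnegrE ?mulr_ge0 ?divr_ge0 ?ler0n//.
  rewrite exprMn e2; have : p ^+ 2 * X * a <= a / 2 * a by apply: ler_wpM2r => //; lra.
  by have := sqr_ge0 a; lra.
rewrite lerBrDr addrC -lerBrDr -(@ler_pXn2r _ 2) ?nnegrE ?subr_ge0//.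
by have := sqr_ge0 e; lra.
Qed.

Let step_contraction : exists2 theta, 0 <= theta < 1 &
  forall u, gap (next u) <= theta * gap u.
Proof.
have X1 : mu / l <= 1 by rewrite ler_pdivrMr// mul1r.
have X0 : 0 < mu / l by rewrite divr_gt0.
(* PL turns the decrease 7/8 eta g^2 into 7/8 * 2 eta mu = 7/16 * mu / l times the squared root
   gap. *)
exists (Num.sqrt (1 - 7 / 16 * (mu / l))).
  by rewrite sqrtr_ge0 -[ltRHS]sqrtr1 ltr_sqrt//; lra.
move=> u; rewrite -(@ler_pXn2r _ 2) ?nnegrE ?mulr_ge0 ?sqrtr_ge0//.
rewrite (le_trans (gap_next u))// exprMn (@sqr_sqrtr _ (1 - _)); last by lra.
have : eta * (2 * mu * gap u ^+ 2) <= eta * enorm (G u) ^+ 2.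
  by rewrite gap2 ler_wpM2l// invr_ge0 mulr_ge0// ltW.
have -> : eta * (2 * mu * gap u ^+ 2) = mu / l * gap u ^+ 2 / 2.
  by rewrite /eta; field; rewrite gt_eqF.
by lra.
Qed.

(* Gradient descent with step 1/(4l) has length at most
   sqrt (3 (h u - m) / mu), and its limit is a critical point. The classical
   constant 2 instead of 3 would need vanishing steps. *)
Lemma quadratic_growth u :
  exists v, h v = m /\ enorm (v - u) ^+ 2 <= 3 / mu * (h u - m).
Proof.
have [theta /andP[th0 th1] thP] := step_contraction.
pose z k := iter k next u.
have gapz k : gap (z k) <= gap u * theta ^+ k.
  elim: k => [|k IH]; first by rewrite expr0 mulr1.
  by rewrite (le_trans (thP _))// exprS mulrCA ler_wpM2l.
have gap0 : (fun k => gap (z k)) @ \oo --> (0 : R).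
  apply: (@squeeze_cvgr _ _ _ _ (fun=> 0) (geometric (gap u) theta)).
  - by near=> k; rewrite gap_ge0 /= gapz.
  - exact: cvg_cst.
  - by apply: cvg_geometric; rewrite ger0_norm.
have Kgap0 : (fun k => K * gap (z k)) @ \oo --> (0 : R).
  by rewrite -(mulr0 K); apply: cvgM => //; exact: cvg_cst.
have [|v vP] := @finite_length_cvg _ _ z (fun k => K * gap (z k)) _ Kgap0.
  by move=> k; exact: step_length.
(* Compare with the iterate [z k]: its gradient is at most [Num.sqrt (2 * l)] times its root gap,
   and the Lipschitz bound over the remaining distance [K * gap (z k)] controls the difference. *)
have Gv k : enorm (G v) <= (Num.sqrt (2 * l) + l * K) * gap (z k).
  rewrite -(subrK (G (z k)) (G v)) (le_trans (enormD _ _))// addrC mulrDl lerD//.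
    rewrite -(@ler_pXn2r _ 2) ?nnegrE ?enorm_ge0 ?mulr_ge0 ?sqrtr_ge0//.
    rewrite exprMn (@sqr_sqrtr _ (2 * l)); last by rewrite mulr_ge0 ?ltW.
    by rewrite gap2 (sqr_grad_le (descent_le _)).
  by rewrite (le_trans (lipG _ _))// -mulrA ler_pM2l// enormB vP.
have {}Gv : enorm (G v) = 0.
  apply/eqP; rewrite eq_le enorm_ge0 andbT.
  exact: le0_of_cvg0 gap0 Gv.
exists v; split.
  apply/eqP; rewrite eq_le h_ge andbT -subr_le0.
  have := PL v; rewrite Gv expr0n /=.
  by rewrite pmulr_rle0// mulr_gt0.
have := vP 0%N; rewrite enormB.
rewrite -(@ler_pXn2r _ 2) ?nnegrE ?enorm_ge0 ?mulr_ge0 ?sqrtr_ge0// exprMn gap2.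
by rewrite (@sqr_sqrtr _ (3 / mu))// divr_ge0 ?ltW.
Unshelve. all: by end_near.
Qed.

End GradientDescent.

(* [a] and [b] are the gaps of the primal and of the inner problem, [da] is the
   increment of [a], [X], [TP] and [TE] are tau1 times the squared norms of
   grad_x f, of the gradient of g and of their difference, k = mu2 / l and
   c = mu1 tau1. *)
Lemma contraction_arith (R : realType) (a b da b' X TP TE k c : R) :
  0 <= a -> 0 <= b -> 0 <= X -> 0 <= k <= 1 -> 0 <= c <= k ^+ 2 / 18 ->
  TE <= k * b / 6 -> 2 * c * a <= TP ->
  da <= - (TP + X - TE) / 2 + k / 9 * X ->
  b' <= (1 - k) * (b + da + X + k ^+ 2 / 36 * X) ->
  a + da + b' / 10 <= (1 - c / 2) * (a + b / 10).
Proof.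
move=> a0 b0 X0 /andP[k0 k1] /andP[c0 c1] HE HP Hda Hb.
have kb : 0 <= k * b by rewrite mulr_ge0.
have kk : k ^+ 2 <= k by nra.
have ca : 0 <= c * a by rewrite mulr_ge0.
have kX : k * X <= X by nra.
have kkX : k ^+ 2 * X <= X by nra.
have cb : c * b <= k * b / 18 by nra.
(* [S] is the weight with which the old gap and the increment [da] enter [b' / 10]. In the final
   sum, X has coefficient at most -3/8 + 37/360 < 0. The b terms are at most b/10 - k b / 120, and k
   b / 120 covers c b / 20 because c b <= k b / 18. *)
pose S := (1 - k) / 10.
have S0 : 0 <= S by rewrite /S; lra.
have S1 : S <= 10^-1 by rewrite /S; lra.
have Hb' : b' / 10 <= S * (b + da + X + k ^+ 2 / 36 * X) by rewrite /S; lra.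
have da' : da <= - c * a - 3 / 8 * X + k * b / 12 by lra.
have H1 : (1 + S) * da <= (1 + S) * (- c * a - 3 / 8 * X + k * b / 12).
  by apply: ler_wpM2l => //; lra.
have H2 : S * (X + k ^+ 2 / 36 * X) <= 37 / 360 * X by nra.
have H3 : S * (k * b) <= k * b / 10 by nra.
have H4 : S * b = b / 10 - k * b / 10 by rewrite /S; lra.
have H5 : 0 <= S * (c * a) by rewrite mulr_ge0.
have H6 : 0 <= S * X by rewrite mulr_ge0.
by lra.
Qed.

(** * Reversed signs, attained extrema, and convergence from Euclidean bounds *)

Lemma gradN (R : realType) (d : nat) (h : 'rV[R]_d -> R) u :
  differentiable h u -> grad (fun v => - h v) u = - grad h u.
Proof.
by move=> dh; apply/rowP => i; rewrite !mxE deriveN//; exact: diff_derivable.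
Qed.

Lemma ascent (R : realType) (d : nat) (h : 'rV[R]_d -> R) (l : R) :
  (forall u, differentiable h u) ->
  (forall u v, enorm (grad h u - grad h v) <= l * enorm (u - v)) ->
  forall u w, h u + dot (grad h u) w - l / 2 * enorm w ^+ 2 <= h (u + w).
Proof.
move=> dh lh u w.
have := @descent _ _ (fun v => - h v) (fun v => differentiableN (dh v)) l _ u w.
rewrite gradN// dotNl => H.
suff : - h (u + w) <= - h u - dot (grad h u) w + l / 2 * enorm w ^+ 2 by lra.
by apply: H => a b; rewrite !gradN// -opprD enormN.
Qed.

Lemma sup_range_max (R : realType) (T : Type) (h : T -> R) (tm : T) :
  (forall t, h t <= h tm) -> sup (range h) = h tm.
Proof.
move=> H; apply/eqP; rewrite eq_le; apply/andP; split.
  by apply: ge_sup; [exists (h tm), tm|move=> _ [t _ <-]].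
by apply: ub_le_sup; [exists (h tm) => _ [t _ <-]|exists tm].
Qed.

Lemma inf_range_min (R : realType) (T : Type) (h : T -> R) (tm : T) :
  (forall t, h tm <= h t) -> inf (range h) = h tm.
Proof.
move=> H; apply/eqP; rewrite eq_le; apply/andP; split.
  by apply: ge_inf; [exists (h tm) => _ [t _ <-]|exists tm].
by apply: lb_le_inf; [exists (h tm), tm|move=> _ [t _ <-]].
Qed.

Lemma enorm_le_cvg (R : realType) (d : nat) (z : nat -> 'rV[R]_d) zs s :
  s @ \oo --> (0 : R) -> (forall t, enorm (z t - zs) <= s t) -> z @ \oo --> zs.
Proof.
move=> s0 zP; apply/cvgrPdist_le => e e0.
near=> t; apply: (le_trans (norm_le_enorm _)).
rewrite enormB (le_trans (zP t))//.
by near: t; exact: (cvgr_le 0 s0 _ e0).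
Unshelve. all: by end_near.
Qed.

(** * The primal function: growth around maximizers, descent inequality and surrogate gradients *)

Section Minimax.
Context {R : realType} {d1 d2 : nat}.
Variables (f : 'rV[R]_d1 -> 'rV[R]_d2 -> R) (mu1 mu2 l : R).
Hypotheses (mu1_gt0 : 0 < mu1) (mu2_gt0 : 0 < mu2) (l_gt0 : 0 < l).
Hypotheses (mu1_le : mu1 <= l) (mu2_le : mu2 <= l).
Hypothesis cdf : continuously_differentiable f.
Hypothesis lipf : lipschitz_gradient f l.
Hypothesis saddlef : saddle_point_existence f.
Hypothesis PLf : two_sided_PL f mu1 mu2.

Let diff_x y u : differentiable (f ^~ y) u.
Proof.
have [df _ _] := cdf.
apply: (@differentiable_comp _ _ _ _ (fun x => (x, y)) (uncurry f)); last exact: df.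
by apply: differentiable_pair; [exact: ex_diff|exact: ex_diff].
Qed.

Let diff_y x v : differentiable (f x) v.
Proof.
have [df _ _] := cdf.
apply: (@differentiable_comp _ _ _ _ (fun y => (x, y)) (uncurry f)); last exact: df.
by apply: differentiable_pair; [exact: ex_diff|exact: ex_diff].
Qed.

Let lip_x y u v : enorm (grad_x f u y - grad_x f v y) <= l * enorm (u - v).
Proof. by have [+ _] := lipf u v y y; rewrite subrr enorm0 addr0. Qed.

Let lip_y x u v : enorm (grad_y f x u - grad_y f x v) <= l * enorm (u - v).
Proof. by have [_] := lipf x x u v; rewrite subrr enorm0 add0r. Qed.

Let descent_x x y w :
  f (x + w) y <= f x y + dot (grad_x f x y) w + l / 2 * enorm w ^+ 2.
Proof. exact: (descent (diff_x y) (@lip_x y)). Qed.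

Let ascent_x x y w :
  f x y + dot (grad_x f x y) w - l / 2 * enorm w ^+ 2 <= f (x + w) y.
Proof. exact: (ascent (diff_x y) (@lip_x y)). Qed.

Let descent_y x y w :
  - f x (y + w) <= - f x y + dot (- grad_y f x y) w + l / 2 * enorm w ^+ 2.
Proof. by have := ascent (diff_y x) (@lip_y x) y w; rewrite dotNl -/(grad_y _ _ _); lra. Qed.

Lemma primal_max x y : (forall y', f x y' <= f x y) -> primal f x = f x y.
Proof. exact: sup_range_max. Qed.

Lemma le_primal x y : f x y <= primal f x.
Proof. by have [_ _ /(_ x)[y' /[dup] y'P /primal_max ->]] := saddlef. Qed.

Lemma primal_minE xs ys : saddle_point f xs ys -> primal_min f = f xs ys.
Proof.
move=> sP; have gs : primal f xs = f xs ys.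
  by apply: primal_max => y; have [] := sP xs y.
rewrite -gs; apply: inf_range_min => x; rewrite gs.
by rewrite (le_trans _ (le_primal x ys))//; have [] := sP x ys.
Qed.

Lemma primal_min_le x : primal_min f <= primal f x.
Proof.
have [[xs [ys /[dup] sP /primal_minE ->]] _ _] := saddlef.
by rewrite (le_trans _ (le_primal x ys))//; have [] := sP x ys.
Qed.

(** Replacing the infimum by an arbitrary competitor [x'] allows comparison with the saddle point
    later. *)
Lemma PL_x x x' y : 2 * mu1 * (f x y - f x' y) <= enorm (grad_x f x y) ^+ 2.
Proof.
have [_ /(_ y)[xm xmP] _] := saddlef; have [+ _] := PLf x y.
rewrite (inf_range_min xmP); apply: le_trans.
by rewrite ler_wpM2l ?lerB// mulr_ge0// ltW.
Qed.

Lemma PL_y x y : 2 * mu2 * (primal f x - f x y) <= enorm (grad_y f x y) ^+ 2.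
Proof. by have [] := PLf x y. Qed.

Let neg_primal_le x y : - primal f x <= - f x y.
Proof. by rewrite lerN2 le_primal. Qed.

Lemma sqr_grad_y_le x y :
  enorm (grad_y f x y) ^+ 2 <= 2 * l * (primal f x - f x y).
Proof.
by have := sqr_grad_le (descent_y x y) l_gt0 (neg_primal_le x);
  rewrite enormN opprK [- f x y + _]addrC.
Qed.

Lemma nearby_maximizer x y : exists y', f x y' = primal f x /\
  enorm (y' - y) ^+ 2 <= 3 / mu2 * (primal f x - f x y).
Proof.
have [||y' [/oppr_inj y'P]] := quadratic_growth l_gt0 (descent_y x)
  (neg_primal_le x) mu2_gt0 mu2_le _ _ y.
- by move=> u v; rewrite -opprD enormN.
- by move=> u; rewrite enormN opprK [- f x u + _]addrC; exact: PL_y.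
by rewrite opprK [- f x y + _]addrC; exists y'.
Qed.

Let L := 4 * l ^+ 2 / mu2.

(* [grad_x f x y] at a maximizer [y] plays the role of the gradient of
   [primal f], whose differentiability is thus not needed. *)
Lemma primal_descent x y w : f x y = primal f x ->
  primal f (x + w) <= primal f x + dot (grad_x f x y) w + L / 2 * enorm w ^+ 2.
Proof.
move=> xy.
have gy0 : enorm (grad_y f x y) = 0.
  apply/eqP; rewrite -sqrf_eq0 eq_le sqr_ge0 andbT.
  by have := sqr_grad_y_le x y; rewrite xy subrr mulr0.
have [y' [xwy' y'P]] := nearby_maximizer (x + w) y.
have w0 := enorm_ge0 w.
have k0 : 0 < l / mu2 by rewrite divr_gt0.
(* At [x + w] the gradient in y has norm at most [l * enorm w], so by PL the gap of [y] is at most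
   [(l * enorm w) ^+ 2 / (2 * mu2)]. Quadratic growth gives the squared distance 3/2 (l/mu2)^2
   |w|^2, and 3/2 <= (3/2)^2 avoids a root. *)
have yy' : enorm (y' - y) <= 3 / 2 * (l / mu2) * enorm w.
  have [_] := lipf (x + w) x y y; rewrite subrr enorm0 addr0.
  rewrite (_ : x + w - x = w); last by rewrite addrAC subrr add0r.
  move=> gle; have {}gle : enorm (grad_y f (x + w) y) <= l * enorm w.
    rewrite -[grad_y f (x + w) y](subrK (grad_y f x y)).
    by rewrite (le_trans (enormD _ _))// gy0 addr0.
  have := PL_y (x + w) y.
  have gle2 : enorm (grad_y f (x + w) y) ^+ 2 <= (l * enorm w) ^+ 2.
    by rewrite ler_pXn2r ?nnegrE ?enorm_ge0// mulr_ge0// ltW.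
  move=> /le_trans /(_ gle2); rewrite -ler_pdivlMl ?mulr_gt0// => gap.
  rewrite -(@ler_pXn2r _ 2) ?nnegrE ?enorm_ge0//; last first.
    by rewrite !mulr_ge0 ?invr_ge0 ?enorm_ge0 ?ler0n ?ltW.
  rewrite (le_trans y'P)//.
  apply: (@le_trans _ _ (3 / mu2 * ((2 * mu2)^-1 * (l * enorm w) ^+ 2))).
    by rewrite ler_wpM2l// divr_ge0 ?ltW.
  rewrite [leLHS](_ : _ = 3 / 2 * (l / mu2 * enorm w) ^+ 2).
    by have := sqr_ge0 (l / mu2 * enorm w); lra.
  by field; rewrite gt_eqF.
have [gg _] := lipf x x y' y; rewrite subrr enorm0 add0r in gg.
have dd : dot (grad_x f x y') w - dot (grad_x f x y) w <=
    l * (3 / 2 * (l / mu2) * enorm w) * enorm w.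
  rewrite -dotNl -dotDl (le_trans (dot_le _ _))// ler_wpM2r//.
  by rewrite (le_trans gg)// ler_wpM2l// ltW.
rewrite -xwy'; apply: (le_trans (descent_x x y' w)).
have := le_primal x y'.
(* Changing the maximizer costs 3/2 l^2/mu2 and smoothness in x costs l/2; since mu2 <= l, the sum
   is at most 2 l^2/mu2 = L/2. *)
have -> : L / 2 = l * (2 * (l / mu2)) by rewrite /L; field; rewrite gt_eqF.
have : 0 <= (l / mu2 - 1) * (l * enorm w ^+ 2).
  by rewrite mulr_ge0 ?subr_ge0 ?ler_pdivlMr ?mul1r// mulr_ge0 ?sqr_ge0 ?ltW.
by lra.
Qed.

(** Take for [p] the x-gradient at a maximizer close to [y]; the error bound is then the Lipschitz
    constant times quadratic growth. PL passes to the primal function because at a saddle point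
    [(xs, ys)] one has [f xs ym <= f xs ys = primal_min f]. *)
Lemma surrogate_gradient x y : exists p,
  [/\ enorm (grad_x f x y - p) ^+ 2 <= 3 * l ^+ 2 / mu2 * (primal f x - f x y),
      forall w, primal f (x + w) <=
        primal f x + dot p w + L / 2 * enorm w ^+ 2
    & 2 * mu1 * (primal f x - primal_min f) <= enorm p ^+ 2].
Proof.
have [ym [xym ymP]] := nearby_maximizer x y.
exists (grad_x f x ym); split.
- have [+ _] := lipf x x y ym; rewrite subrr enorm0 add0r => le1.
  apply: (@le_trans _ _ ((l * enorm (y - ym)) ^+ 2)).
    by rewrite ler_pXn2r ?nnegrE ?enorm_ge0// mulr_ge0 ?enorm_ge0 ?ltW.
  rewrite enormB exprMn; have := ler_wpM2l (sqr_ge0 l) ymP.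
  by lra.
- by move=> w; exact: primal_descent.
- have [[xs [ys /[dup] sP /primal_minE gE]] _ _] := saddlef.
  apply: le_trans (PL_x x xs ym).
  apply: ler_wpM2l; first by rewrite mulr_ge0// ltW.
  rewrite xym gE lerD2l lerN2.
  by have [] := sP xs ym.
Qed.

(** * Contraction of the potential in one step *)

Let tau := mu2 ^+ 2 / (18 * l ^+ 3).
Let rate := 1 - mu1 * mu2 ^+ 2 / (36 * l ^+ 3).

Lemma AGDA_step x y x' y' : x' = x - tau *: grad_x f x y ->
  y' = y + (1 / l) *: grad_y f x' y ->
  potential f x' y' <= rate * potential f x y.
Proof.
move=> x'E y'E.
have [p [E_le desc PLp]] := surrogate_gradient x y.
have k01 : 0 <= mu2 / l <= 1.
  by rewrite divr_ge0 ?(ltW mu2_gt0) ?(ltW l_gt0)//= ler_pdivrMr// mul1r.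
have tau_ge0 : 0 <= tau by rewrite divr_ge0 ?sqr_ge0// mulr_ge0 ?exprn_ge0 ?ltW.
have k1 : mu1 / l <= 1 by rewrite ler_pdivrMr// mul1r.
have /andP[k0 kle1] := k01.
set q := grad_x f x y in x'E E_le.
have da_le := desc (- (tau *: q)); rewrite -x'E in da_le.
rewrite dotNr dotZr enormN enormZ ger0_norm// in da_le.
(* Polarization keeps a negative multiple of [enorm q ^+ 2], which absorbs the curvature terms, and
   isolates the surrogate error. *)
have dotE : dot p q = (enorm p ^+ 2 + enorm q ^+ 2 - enorm (q - p) ^+ 2) / 2.
  by rewrite !sqr_enorm !(dotDl, dotDr, dotNl, dotNr) (dotC q p); field.
(* The inner gap after the x-step but before the y-step; the lower quadratic model in x bounds the
   drop of [f] at fixed [y]. *)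
have gap_le : primal f x' - f x' y <= primal f x - f x y +
    (primal f x' - primal f x) + tau * enorm q ^+ 2 +
    (mu2 / l) ^+ 2 / 36 * (tau * enorm q ^+ 2).
  have := ascent_x x y (- (tau *: q)); rewrite -x'E -/q.
  rewrite dotNr dotZr enormN enormZ ger0_norm// -sqr_enorm.
  have -> : l / 2 * (tau * enorm q) ^+ 2 =
      (mu2 / l) ^+ 2 / 36 * (tau * enorm q ^+ 2).
    by rewrite /tau; field; rewrite gt_eqF.
  by lra.
(* At fixed [x'] the y-update is a gradient step of size 1/l on [- f x'], and PL makes it contract
   the gap. *)
have gap'_le : primal f x' - f x' y' <=
    (1 - mu2 / l) * (primal f x' - f x' y).
  have := @gradient_step _ _ (fun v => - f x' v) _ _ _ (descent_y x' y) (1 / l).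
  rewrite scalerN opprK -y'E enormN.
  have -> : 1 / l * (1 - l * (1 / l) / 2) = l^-1 / 2.
    by field; rewrite gt_eqF.
  have := ler_wpM2l (ltW (_ : 0 < l^-1 / 2)) (PL_y x' y).
  rewrite divr_gt0 ?invr_gt0// => /(_ isT).
  have -> : l^-1 / 2 * (2 * mu2 * (primal f x' - f x' y)) =
     mu2 / l * (primal f x' - f x' y) by field; rewrite gt_eqF.
  by lra.
have -> : potential f x' y' = primal f x - primal_min f +
    (primal f x' - primal f x) + (primal f x' - f x' y') / 10.
  by rewrite /potential; lra.
have -> : potential f x y = primal f x - primal_min f + (primal f x - f x y) / 10.
  by rewrite /potential; lra.
have -> : rate = 1 - mu1 * tau / 2.
  by rewrite /rate /tau; field; rewrite gt_eqF.
(* The choice of [tau] gives, with k = mu2 / l, tau * 3 l^2 / mu2 = k / 6, L tau / 2 = k / 9, l tau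
   / 2 = k^2 / 36 and mu1 tau <= k^2 / 18. *)
apply: (@contraction_arith _ _ _ _ _ (tau * enorm q ^+ 2) (tau * enorm p ^+ 2)
  (tau * enorm (q - p) ^+ 2) (mu2 / l)) => //.
- by rewrite subr_ge0 primal_min_le.
- by rewrite subr_ge0 le_primal.
- by rewrite mulr_ge0 ?sqr_ge0.
- apply/andP; split; first by rewrite mulr_ge0// ltW.
  have -> : mu1 * tau = mu1 / l * ((mu2 / l) ^+ 2 / 18).
    by rewrite /tau; field; rewrite gt_eqF.
  by rewrite ler_piMl// divr_ge0 ?sqr_ge0.
- apply: (le_trans (ler_wpM2l tau_ge0 E_le)).
  by rewrite le_eqVlt; apply/orP; left; apply/eqP; rewrite /tau; field; rewrite !gt_eqF.
- by have := ler_wpM2l tau_ge0 PLp; lra.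
- have : L / 2 * (tau * enorm q) ^+ 2 = mu2 / l / 9 * (tau * enorm q ^+ 2).
    by rewrite /L /tau; field; rewrite !gt_eqF.
  by rewrite dotE in da_le; lra.
- by rewrite (le_trans gap'_le)// ler_wpM2l// subr_ge0.
Qed.

(** * Gradient bounds by the potential, and criticality *)

Lemma potential_ge0 x y : 0 <= potential f x y.
Proof. by rewrite addr_ge0 ?mulr_ge0 ?subr_ge0 ?primal_min_le ?le_primal. Qed.

Let K := 60 * l ^+ 2 / mu2.

(** Splitting the gradient into surrogate and error gives 2 (3 l^2/mu2 b + 2 L a) = l^2/mu2 (6 b +
    16 a). As b has weight 1/10 in the potential, 60 l^2/mu2 covers both terms. *)
Lemma sqr_grad_x_le_potential x y :
  enorm (grad_x f x y) ^+ 2 <= K * potential f x y.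
Proof.
have [p [E_le desc _]] := surrogate_gradient x y.
have L_gt0 : 0 < L by rewrite divr_gt0// mulr_gt0 ?exprn_gt0.
have p_le := sqr_grad_le desc L_gt0 (fun v => primal_min_le v).
set q := grad_x f x y in E_le *.
have q_le : enorm q ^+ 2 <= 2 * (enorm (q - p) ^+ 2 + enorm p ^+ 2).
  have := dot_ge0 (q - p - p).
  by rewrite !sqr_enorm !(dotDl, dotDr, dotNl, dotNr) (dotC q p); lra.
have l2 : 0 < l ^+ 2 / mu2 by rewrite divr_gt0 ?exprn_gt0.
have a_ge0 : 0 <= l ^+ 2 / mu2 * (primal f x - primal_min f).
  by rewrite mulr_ge0 ?(ltW l2)// subr_ge0 primal_min_le.
by rewrite /potential /K; rewrite /L in p_le; lra.
Qed.

Lemma sqr_grad_y_le_potential x y :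
  enorm (grad_y f x y) ^+ 2 <= K * potential f x y.
Proof.
apply: (le_trans (sqr_grad_y_le x y)).
have k1 : 1 <= l / mu2 by rewrite ler_pdivlMr// mul1r.
have a_ge0 : 0 <= l / mu2 * l * (primal f x - primal_min f).
  by rewrite !mulr_ge0 ?invr_ge0 ?(ltW l_gt0) ?(ltW mu2_gt0)// subr_ge0 primal_min_le.
have b_ge0 : 0 <= (l / mu2 - 1) * (l * (primal f x - f x y)).
  by rewrite !mulr_ge0 ?(ltW l_gt0)// subr_ge0// le_primal.
have -> : K = 60 * (l / mu2) * l by rewrite /K; field; rewrite gt_eqF.
have b0 : 0 <= l * (primal f x - f x y).
  by rewrite mulr_ge0 ?(ltW l_gt0)// subr_ge0 le_primal.
by rewrite /potential; lra.
Qed.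

Lemma critical_saddle_point xs ys :
  enorm (grad_x f xs ys) = 0 -> enorm (grad_y f xs ys) = 0 ->
  saddle_point f xs ys.
Proof.
move=> gx0 gy0 x y; split.
  apply: (le_trans (le_primal xs y)); have := PL_y xs ys.
  by rewrite gy0 expr0n pmulr_rle0 ?mulr_gt0// subr_le0.
by have := PL_x xs x ys; rewrite gx0 expr0n pmulr_rle0 ?mulr_gt0// subr_le0.
Qed.

(** * Linear convergence of the iterates *)

Variables (x : nat -> 'rV[R]_d1) (y : nat -> 'rV[R]_d2).
Hypothesis agda : AGDA f tau (1 / l) x y.

Let P t := potential f (x t) (y t).

Lemma rate_itv : 0 < rate < 1.
Proof.
have c0 : 0 < mu1 * mu2 ^+ 2 / (36 * l ^+ 3).
  by rewrite divr_gt0 ?mulr_gt0 ?exprn_gt0.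
have : mu1 * mu2 ^+ 2 / (36 * l ^+ 3) <= 36^-1.
  rewrite ler_pdivrMr ?mulr_gt0 ?exprn_gt0// mulKf// [l ^+ 3]exprS.
  by rewrite ler_pM ?sqr_ge0 ?(ltW mu1_gt0)// ler_pXn2r ?nnegrE ?(ltW mu2_gt0) ?(ltW l_gt0).
by rewrite /rate; lra.
Qed.

Lemma AGDA_potential t : P t <= rate ^+ t * P 0.
Proof.
have /andP[/ltW r0 _] := rate_itv.
elim: t => [|t IH]; first by rewrite expr0 mul1r.
have [xE yE] := agda t; rewrite exprS -mulrA.
by rewrite (le_trans (AGDA_step xE yE))// ler_wpM2l.
Qed.

Let r := Num.sqrt rate.
Let B := Num.sqrt (K * P 0).
Let M := (1 / l + tau) * B.
(** The tail from t of the geometric series with terms [M * r ^+ k], which bound the steps in x and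
    in y. The ratio is the root of [rate] because gradients are controlled by the root of the
    potential. *)
Let s t := M / (1 - r) * r ^+ t.

Lemma AGDA_cvg : exists xs ys, [/\ saddle_point f xs ys,
    (fun t => (x t, y t)) @ \oo --> (xs, ys)
  & forall t, enorm (x t - xs) ^+ 2 + enorm (y t - ys) ^+ 2 <=
      2 * (1 / l + tau) ^+ 2 * K / (1 - r) ^+ 2 * rate ^+ t * P 0].
Proof.
have /andP[r0 r1] := rate_itv.
have rE : r ^+ 2 = rate by rewrite sqr_sqrtr// ltW.
have rge0 : 0 <= r by exact: sqrtr_ge0.
have rlt1 : r < 1 by rewrite -(@ltr_pXn2r _ 2) ?nnegrE// rE expr1n.
have r1_gt0 : 0 < 1 - r by rewrite subr_gt0.
have K0 : 0 < K by rewrite divr_gt0// mulr_gt0// exprn_gt0.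
have B0 : 0 <= B by exact: sqrtr_ge0.
have BE : B ^+ 2 = K * P 0.
  by rewrite sqr_sqrtr// mulr_ge0 ?(ltW K0)// potential_ge0.
have tau0 : 0 <= tau by rewrite divr_ge0 ?sqr_ge0// mulr_ge0 ?exprn_ge0 ?ltW.
have li0 : 0 < 1 / l by rewrite divr_gt0.
have M0 : 0 <= M by rewrite mulr_ge0// addr_ge0// ltW.
have bound a t : 0 <= a -> a ^+ 2 <= K * P t -> a <= B * r ^+ t.
  move=> a0 aP; rewrite -(@ler_pXn2r _ 2) ?nnegrE ?mulr_ge0 ?exprn_ge0//.
  rewrite (le_trans aP)// exprMn BE exprAC rE -[leRHS]mulrA.
  apply: ler_wpM2l; first exact: ltW.
  by rewrite mulrC AGDA_potential.
have qx t : enorm (grad_x f (x t) (y t)) <= B * r ^+ t.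
  by apply: bound; [exact: enorm_ge0|exact: sqr_grad_x_le_potential].
have qy t : enorm (grad_y f (x t) (y t)) <= B * r ^+ t.
  by apply: bound; [exact: enorm_ge0|exact: sqr_grad_y_le_potential].
have sE t : s t - s t.+1 = M * r ^+ t.
  by rewrite /s exprS; field; rewrite gt_eqF.
have s0 : s @ \oo --> (0 : R).
  have -> : s = geometric (M / (1 - r)) r by [].
  by apply: cvg_geometric; rewrite ger0_norm.
have Brt t : 0 <= B * r ^+ t by rewrite mulr_ge0// exprn_ge0.
have stepx t : enorm (x t.+1 - x t) <= tau * (B * r ^+ t).
  have [-> _] := agda t; rewrite addrAC subrr add0r enormN enormZ ger0_norm//.
  by rewrite ler_wpM2l.
have stepy t : enorm (y t.+1 - y t) <= (1 / l + tau) * (B * r ^+ t).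
  have [_ ->] := agda t.
  rewrite addrAC subrr add0r enormZ gtr0_norm// mulrDl.
  (* The y-update uses the gradient at the new x-iterate; moving it back to the old one costs l *
     tau * B r^t, which after the factor 1/l is the summand [tau] in [M]. *)
  rewrite -[grad_y f _ _](subrK (grad_y f (x t) (y t))).
  apply: (le_trans (ler_wpM2l (ltW li0) (enormD _ _))).
  rewrite mulrDr addrC lerD//; first by rewrite ler_wpM2l// ltW.
  have [_] := lipf (x t.+1) (x t) (y t) (y t); rewrite subrr enorm0 addr0 => H.
  apply: (le_trans (ler_wpM2l (ltW li0) H)).
  by rewrite mulrA div1r mulVf ?gt_eqF// mul1r.
have [xs xsP] : exists xs, forall n, enorm (x n - xs) <= s n.
  apply: finite_length_cvg s0 => t; rewrite sE (le_trans (stepx t))//.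
  by rewrite /M -mulrA ler_wpM2r// lerDr ltW.
have [ys ysP] : exists ys, forall n, enorm (y n - ys) <= s n.
  by apply: finite_length_cvg s0 => t; rewrite sE (le_trans (stepy t))// mulrA.
have rt0 : (fun t => r ^+ t) @ \oo --> (0 : R).
  by apply: cvg_expr; rewrite ger0_norm.
have lim_le t : l * (enorm (xs - x t) + enorm (ys - y t)) <=
    2 * l * (M / (1 - r)) * r ^+ t.
  have -> : 2 * l * (M / (1 - r)) * r ^+ t = l * (s t + s t) by rewrite /s; ring.
  apply: ler_wpM2l; first exact: ltW.
  by rewrite enormB (enormB ys) lerD.
(* As in [quadratic_growth], the gradient at the limit is at most that at iterate t plus l times the
   remaining distances, all of order r^t. *)
have crit_x : enorm (grad_x f xs ys) <= 0.
  apply: (@le0_of_cvg0 _ _ (2 * l * (M / (1 - r)) + B) _ rt0) => t.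
  rewrite -[grad_x f _ _](subrK (grad_x f (x t) (y t))) mulrDl.
  rewrite (le_trans (enormD _ _))// lerD//.
  by have [H _] := lipf xs (x t) ys (y t); apply: le_trans H _.
have crit_y : enorm (grad_y f xs ys) <= 0.
  apply: (@le0_of_cvg0 _ _ (2 * l * (M / (1 - r)) + B) _ rt0) => t.
  rewrite -[grad_y f _ _](subrK (grad_y f (x t) (y t))) mulrDl.
  rewrite (le_trans (enormD _ _))// lerD//.
  by have [_ H] := lipf xs (x t) ys (y t); apply: le_trans H _.
exists xs, ys; split.
- by apply: critical_saddle_point; apply/eqP; rewrite eq_le enorm_ge0 andbT.
- by apply: (cvg_pair (enorm_le_cvg s0 xsP) (enorm_le_cvg s0 ysP)).
(* Both squared errors are at most [s t ^+ 2], and [B ^+ 2 = K * P 0] brings out the initial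
   potential. *)
- move=> t; have -> : 2 * (1 / l + tau) ^+ 2 * K / (1 - r) ^+ 2 * rate ^+ t * P 0 =
      s t ^+ 2 + s t ^+ 2.
    rewrite /s /M !exprMn BE exprAC rE exprVn; ring.
  have s_ge0 : 0 <= s t by rewrite mulr_ge0 ?exprn_ge0// divr_ge0// ltW.
  by rewrite lerD// ler_pXn2r ?nnegrE ?enorm_ge0.
Qed.

End Minimax.

Theorem theorem3p2 (R : realType) (mu1 mu2 l : R)
    (hmu1 : 0 < mu1) (hmu2 : 0 < mu2) (hl : 0 < l)
    (hmu1l : mu1 <= l) (hmu2l : mu2 <= l) :
  exists alpha : R,
    forall (d1 d2 : nat) (f : 'rV[R]_d1 -> 'rV[R]_d2 -> R)
      (x : nat -> 'rV[R]_d1) (y : nat -> 'rV[R]_d2),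
      continuously_differentiable f ->
      lipschitz_gradient f l ->
      saddle_point_existence f ->
      two_sided_PL f mu1 mu2 ->
      AGDA f (mu2 ^+ 2 / (18 * l ^+ 3)) (1 / l) x y ->
      (forall t : nat,
         potential f (x t) (y t)
           <= (1 - mu1 * mu2 ^+ 2 / (36 * l ^+ 3)) ^+ t
              * potential f (x 0%N) (y 0%N)) /\
      exists (xs : 'rV[R]_d1) (ys : 'rV[R]_d2),
        [/\ saddle_point f xs ys,
            (fun t : nat => (x t, y t)) @ \oo --> (xs, ys)
          & forall t : nat,
              enorm (x t - xs) ^+ 2 + enorm (y t - ys) ^+ 2
                <= alpha * (1 - mu1 * mu2 ^+ 2 / (36 * l ^+ 3)) ^+ t
                   * potential f (x 0%N) (y 0%N)].
Proof.
(* The witness [alpha] is read off from [AGDA_cvg]. Being chosen before the dimensions, [f] and the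
   iterates are introduced, it can involve only [mu1], [mu2] and [l]. *)
eexists => d1 d2 f x y cdf lipf saddlef PLf agda; split.
  exact: (AGDA_potential hmu1 hmu2 hl hmu1l hmu2l cdf lipf saddlef PLf agda).
exact: (AGDA_cvg hmu1 hmu2 hl hmu1l hmu2l cdf lipf saddlef PLf agda).
Qed.
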